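(* Let $\mathscr{F}$ be a sheaf of functions on $\Omega$ satisfying property $(\mathscr{F}1)$ and assume that the topology of $\mathscr{F}(Y)$ is the compact-open topology for every open $Y\subseteq\Omega$. Let $X\subseteq\Omega$ be open, let $w:X\to\mathbb{K}$ and $\psi:X\to X$ be continuous, and assume that the weighted composition operator $C_{w,\psi}:\mathscr{F}(X)\to\mathscr{F}(X)$, $f\mapsto w\cdot(f\circ\psi)$, is well-defined. Assume that additionally the following conditions hold. (a) There is an open, relatively compact exhaustion $(X_n)_{n\in\mathbb{N}}$ of $X$ such that for each $n\in\mathbb{N}$, every $x\in X\setminus\overline{X}_n$ and every open $W\subseteq X\setminus\overline{X}_n$ containing $x$ there is an open $U\subseteq W$ with $x\in U$ for which the restriction $r_X^{X_n\cup U}:\mathscr{F}(X)\to\mathscr{F}(X_n\cup U)$ has dense range. (b) $\ker\delta_x\neq\mathscr{F}(X)$ for each $x\in X$. (c) For every $m\in\mathbb{N}_0$ the set $\{y\in X:\ w(\psi^m(y))\neq 0\}$ is dense in $X$. Then the following are equivalent. (i) $C_{w,\psi}$ is $m$-topologizable on $\mathscr{F}(X)$. (ii) $C_{w,\psi}$ is topologizable on $\mathscr{F}(X)$. (iii) $\psi$ has stable orbits.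
   Context: $\mathbb{K}\in\{\mathbb{R},\mathbb{C}\}$; $\Omega$ is a locally compact, $\sigma$-compact, non-compact Hausdorff space. A sheaf of functions $\mathscr{F}$ on $\Omega$ assigns to every open $X\subseteq\Omega$ a vector space $\mathscr{F}(X)$ of $\mathbb{K}$-valued functions on $X$ such that for open $Y\subseteq X$ the restriction $r_X^Y:\mathscr{F}(X)\to\mathscr{F}(Y)$, $f\mapsto f_{|Y}$, is well-defined, functions in $\mathscr{F}(X)$ agreeing on all members of an open cover of $X$ are equal, and for every open cover $(X_\iota)_{\iota\in I}$ of $X$ and $f_\iota\in\mathscr{F}(X_\iota)$ with $f_\iota=f_\kappa$ on $X_\iota\cap X_\kappa$ for all $\iota,\kappa\in I$ there is $f\in\mathscr{F}(X)$ with $f_{|X_\iota}=f_\iota$ for all $\iota$. An open, relatively compact exhaustion of $X$ is a sequence $(X_n)$ of open subsets of $X$ with compact closures $\overline{X}_n\subseteq X_{n+1}$ and $\bigcup_n X_n=X$. $\mathscr{F}$ satisfies $(\mathscr{F}1)$ if for every open $X\subseteq\Omega$: $\mathscr{F}(X)$ is a webbed and ultrabornological Hausdorff locally convex space; $\mathscr{F}(X)\subseteq C(X)$ (continuous $\mathbb{K}$-valued functions); for each $x\in X$ the point evaluation $\delta_x:f\mapsto f(x)$ is a continuous linear functional on $\mathscr{F}(X)$; and for every open, relatively compact exhaustion $(X_n)$ of $X$ the canonical map $f\mapsto(f_{|X_n})_n$ is a topological isomorphism of $\mathscr{F}(X)$ onto the projective limit $\{(f_n)_n\in\prod_n\mathscr{F}(X_n):\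 f_n=f_{n+1|X_n}\ \forall n\}$ (with the topology induced by the product). The compact-open topology is defined by the seminorms $\|f\|_K=\sup_{x\in K}|f(x)|$, $K\subseteq X$ compact. $\psi^m$ is the $m$-fold iterate of $\psi$ ($\psi^0=\mathrm{id}$). A continuous map $\psi:X\to X$ has stable orbits if for every compact $K\subseteq X$ there is a compact $L\subseteq X$ with $\psi^m(K)\subseteq L$ for all $m\in\mathbb{N}$. A continuous linear operator $T$ on a locally convex space $E$ is topologizable if for every continuous seminorm $p$ on $E$ there is a continuous seminorm $q$ on $E$ such that for every $m\in\mathbb{N}$ there is $\gamma_m>0$ with $p(T^m x)\le\gamma_m q(x)$ for all $x\in E$. $T$ is $m$-topologizable if for every continuous seminorm $p$ there are a continuous seminorm $q$ and $\gamma>0$ such that $p(T^m x)\le\gamma^m q(x)$ for all $m\in\mathbb{N}$, $x\in E$. *)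

(* Defs.v *)
From HB Require Import structures.
From mathcomp Require Import all_boot all_order all_algebra.
From mathcomp Require Import complex.
From mathcomp Require Import all_classical all_reals all_analysis.

Set Implicit Arguments.
Unset Strict Implicit.
Unset Printing Implicit Defensive.

Import Order.TTheory GRing.Theory Num.Theory.
Import numFieldNormedType.Exports.

Local Open Scope classical_set_scope.
Local Open Scope ring_scope.

(* [scalar_field R K]: K is the field of real or of complex numbers.  In both
   cases the order of K restricts to the usual order on the reals, and
   0 <= z forces z to be real, so nonnegative reals are represented as the
   nonnegative elements of K (as for the norm of a [numFieldType]). *)
Variant scalar_field (R : realType) : numFieldType -> Prop :=
| ScalarReal : scalar_field R R
| ScalarComplex : scalar_field R R[i].

Section LocallyConvexSpaces.
Context (K : numFieldType) (E : tvsType K).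

Definition seminorm (p : E -> K) : Prop :=
  [/\ forall x, 0 <= p x,
      forall x y, p (x + y) <= p x + p y
    & forall a x, p (a *: x) = `|a| * p x].

Definition continuous_seminorm (p : E -> K) : Prop :=
  seminorm p /\ continuous p.

Definition absolutely_convex (U : set E) : Prop :=
  forall x y a b, U x -> U y -> `|a| + `|b| <= 1 -> U (a *: x + b *: y).

Definition absorbing (U : set E) : Prop :=
  forall x, exists2 r : K, 0 < r & U (r *: x).

(* De Wilde's webs of absolutely convex sets.  The set C_{n_1,...,n_k} is
   [C [:: n_1; ...; n_k]], with the empty index list standing for E itself. *)
Definition web (C : seq nat -> set E) : Prop :=
  [/\ forall s, absolutely_convex (C s),
      C [::] = [set: E],
      forall s, C s = \bigcup_n C (rcons s n)
    & forall nu : nat -> nat, exists2 lambda : nat -> K,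
        (forall k, 0 < lambda k) &
        forall x : nat -> E, (forall k, C (mkseq nu k.+1) (x k)) ->
          exists l : E, series (fun k => lambda k *: x k) @ \oo --> l].

Definition webbed : Prop := exists C, web C.

(* E carries the inductive topology of a family of Banach spaces, i.e. the
   finest locally convex topology that makes all the maps j_i continuous. *)
Definition ultrabornological : Prop :=
  exists (I : Type) (B : I -> completeNormedModType K)
         (j : forall i, {linear B i -> E}),
    forall A : set E, nbhs 0 A <->
      exists U, [/\ absolutely_convex U, absorbing U,
                    forall i, nbhs 0 (j i @^-1` U) & U `<=` A].

(* The index m ranges over the positive integers. *)
Definition topologizable (T : E -> E) : Prop :=
  [/\ linear T, continuous T &
    forall p, continuous_seminorm p ->
      exists2 q, continuous_seminorm q &
        forall m, (0 < m)%N ->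
          exists2 gamma : K, 0 < gamma &
            forall x, p (iter m T x) <= gamma * q x].

Definition m_topologizable (T : E -> E) : Prop :=
  [/\ linear T, continuous T &
    forall p, continuous_seminorm p ->
      exists2 q, continuous_seminorm q &
        exists2 gamma : K, 0 < gamma &
          forall m, (0 < m)%N ->
            forall x, p (iter m T x) <= gamma ^+ m * q x].

End LocallyConvexSpaces.

Section Topology.

Definition sigma_compact (T : topologicalType) : Prop :=
  exists2 C : nat -> set T, (forall n, compact (C n)) &
    \bigcup_n C n = [set: T].

Definition stable_orbits (T : topologicalType) (psi : T -> T) : Prop :=
  forall C : set T, compact C ->
    exists2 L : set T, compact L &
      forall m, (0 < m)%N -> iter m psi @` C `<=` L.

Definition homeomorphism_onto (S T : topologicalType) (L : set T)
    (h : S -> T) : Prop :=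
  [/\ set_bij [set: S] L h, continuous h &
    forall U, open U -> exists2 V, open V & h @` U = L `&` V].

(* The closures are taken in the ambient space: when it is Hausdorff, compact
   closures in X and in the ambient space are the same. *)
Definition exhaustion (T : topologicalType) (X : set T)
    (Xn : nat -> set T) : Prop :=
  [/\ forall n, open (Xn n),
      forall n, compact (closure (Xn n)),
      forall n, closure (Xn n) `<=` Xn n.+1
    & \bigcup_n Xn n = X].

End Topology.

(* f = g on the intersection of X and Y; if Y is included in X, this says that
   g is the restriction of f to Y. *)
Definition coincide (T V : Type) (X Y : set T) (f : X -> V) (g : Y -> V)
  : Prop := forall (x : X) (y : Y), val x = val y -> f x = g y.

(* The space of sections over X is an abstract locally convex space, identified
   with a space of functions on X by the injective linear map [fct]; its
   topology is part of the data but the sheaf axioms do not involve it.  Only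
   the values at open sets X are meaningful. *)
Record function_sheaf (K : numFieldType) (Omega : topologicalType) :=
  FunctionSheaf {
    sections :> set Omega -> tvsType K;
    fct : forall X, sections X -> X -> K;
    fct_linear : forall X a (f g : sections X) x,
      fct (a *: f + g) x = a * fct f x + fct g x;
    fct_inj : forall X, injective (@fct X);
    sheaf_restr : forall X Y, open X -> open Y -> Y `<=` X ->
      forall f : sections X, exists g : sections Y, coincide (fct f) (fct g);
    sheaf_locality : forall X (I : Type) (U : I -> set Omega),
      open X -> (forall i, open (U i)) -> \bigcup_i U i = X ->
      forall f g : sections X,
        (forall i (x : X), U i (val x) -> fct f x = fct g x) -> f = g;
    sheaf_gluing : forall X (I : Type) (U : I -> set Omega),
      open X -> (forall i, open (U i)) -> \bigcup_i U i = X ->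
      forall s : (forall i, sections (U i)),
        (forall i k, coincide (fct (s i)) (fct (s k))) ->
        exists f : sections X, forall i, coincide (fct f) (fct (s i))
  }.

Section SheafNotions.
Context (K : numFieldType) (Omega : topologicalType).
Variable F : function_sheaf K Omega.

(* The restriction map r_X^Y, for open sets Y included in X ([sheaf_restr]). *)
Definition restr (X Y : set Omega) (f : F X) : F Y :=
  xget 0 [set g | coincide (fct f) (fct g)].

Definition proj_limit (Xn : nat -> set Omega) :
    set (prod_topology (fun n => F (Xn n))) :=
  [set f | forall n, f n = restr (Xn n) (f n.+1)].

Definition propertyF1 : Prop :=
  forall X, open X ->
    [/\ webbed (F X) /\ ultrabornological (F X),
        hausdorff_space (F X),
        forall f : F X, continuous (fct f),
        forall x : X, continuous (fun f : F X => fct f x)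
      & forall Xn, exhaustion X Xn ->
          homeomorphism_onto (@proj_limit Xn)
            ((fun f n => restr (Xn n) f) :
               F X -> prod_topology (fun n => F (Xn n)))].

(* The supremum is taken in the partial order of K, where it is the real
   supremum of the absolute values (and 0 if C is empty). *)
Definition sup_norm (T : Type) (C : set T) (f : T -> K) : K :=
  supremum 0 [set `|f x| | x in C].

(* The family of seminorms [sup_norm C] is directed, hence a single compact set
   suffices to describe the basic neighborhoods. *)
Definition has_compact_open_topology (X : set Omega) : Prop :=
  forall (f : F X) (A : set (F X)), nbhs f A <->
    exists (C : set X) (e : K),
      [/\ compact C, 0 < e & [set g | sup_norm C (fct (g - f)) < e] `<=` A].

Section WeightedComposition.
Variables (X : set Omega) (w : X -> K) (psi : X -> X).

Definition is_wcomp (f g : F X) : Prop :=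
  forall x, fct g x = w x * fct f (psi x).

Definition wcomp_well_defined : Prop := forall f, exists g, is_wcomp f g.

(* C_{w,psi}, provided that it is well-defined. *)
Definition wcomp (f : F X) : F X := xget 0 (is_wcomp f).

End WeightedComposition.

End SheafNotions.

(* Main.v *)
(* In the compact-open topology the continuous seminorms are those dominated by
   a multiple of the supremum of |f| over some compact set, so all conditions
   are estimates on
     (C^m f)(x) = w(x) w(psi x) ... w(psi^(m-1) x) f(psi^m x).
   Stable orbits confine all psi^m(D) to one compact set L, on which |w| is
   bounded by a constant M; this gives m-topologizability with factors of order
   M^m.  Conversely, if C is topologizable, let D be contained in X_k and bound
   |C^m f| on the closure of X_k by a multiple of sup_L |f|, where L is
   contained in X_n.  If psi^m(D) left the closure of X_n, then, the weight
   product being nonzero on a dense open set, psi^m(y) would lie outside that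
   closure for some y in X_k at which the weight product is nonzero.  A section
   equal to 0 on X_n and nonzero near psi^m(y) can be approximated by global
   sections, which contradicts the bound.  Hence psi^m(D) stays in the closure
   of X_n for all m. *)

Require Import Defs.
From HB Require Import structures.
From mathcomp Require Import all_boot all_order all_algebra.
From mathcomp Require Import complex.
From mathcomp Require Import all_classical all_reals all_analysis.

Set Implicit Arguments.
Unset Strict Implicit.
Unset Printing Implicit Defensive.

Import Order.TTheory GRing.Theory Num.Theory.
Import numFieldNormedType.Exports.

Local Open Scope classical_set_scope.
Local Open Scope ring_scope.

(** * Suprema of absolute values over compact sets *)

Section SupNorm.
Context (K : numFieldType) (T : topologicalType).
Implicit Types (C : set T) (f : T -> K).

(** The order of [K] is only partial, but norms are real and hence comparable. *)
Lemma norm_le_or_lt (x y : K) : (`|x| <= `|y|) \/ (`|y| < `|x|).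
Proof. by case: (real_leP (normr_real x) (normr_real y)); [left | right]. Qed.

(** Without a maximum, each point of [C] is strictly dominated by another one. Along the filter
    generated by the sets of [y] with [|f x| <= |f y|], [x] in [C], this domination holds locally,
    so by compactness uniformly on [C]. A point [x] whose set witnesses this would dominate
    itself. *)
Lemma compact_norm_max C f : compact C -> continuous f -> C !=set0 ->
  exists2 x, C x & forall y, C y -> `|f y| <= `|f x|.
Proof.
move=> /compact_near_coveringP cptC cf [x0 Cx0]; apply: contrapT => nmax.
have larger x : C x -> exists2 y, C y & `|f x| < `|f y|.
  move=> Cx; apply: contrapT => nlt; apply: nmax; exists x => // y Cy.
  by case: (norm_le_or_lt (f y) (f x)) => // lt_xy; case: nlt; exists y.
pose G := filter_from C (fun x => [set y | `|f x| <= `|f y|]).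
have FG : Filter G.
  apply: filter_from_filter; first by exists x0.
  move=> x y Cx Cy; case: (norm_le_or_lt (f x) (f y)) => [xy|/ltW yx].
  - by exists y => // z /= yz; split => //=; exact: le_trans xy yz.
  - by exists x => // z /= xz; split => //=; exact: le_trans yx xz.
have [x Cx lt_x] : \near G, C `<=` (fun x => `|f x| < `|f G|).
  apply: (cptC T G (fun y x => `|f x| < `|f y|)) => x Cx.
  have [y Cy lt_xy] := larger x Cx.
  have e_gt0 : 0 < `|f y| - `|f x| by rewrite subr_gt0.
  exists ([set x' | `|f x - f x'| < `|f y| - `|f x|],
          [set y' | `|f y| <= `|f y'|]).
    by split => /=; [exact: (cvgrPdist_lt _ _).1 (cf x) _ e_gt0 | exists y].
  case=> x' y' [/= near_x le_y].
  rewrite (lt_le_trans _ le_y)// -[f x'](subKr (f x)).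
  by rewrite (le_lt_trans (ler_normB _ _))// -ltrBrDl.
by have := lt_x x (lexx _) x Cx; rewrite ltxx.
Qed.

Lemma sup_norm0 f : sup_norm set0 f = 0.
Proof. by rewrite /sup_norm image_set0 supremum0. Qed.

Lemma sup_norm_max C f x : C x -> (forall y, C y -> `|f y| <= `|f x|) ->
  sup_norm C f = `|f x|.
Proof.
move=> Cx max_x; rewrite /sup_norm /supremum ifF; last first.
  by apply/negbTE/set0P; exists `|f x|, x.
have ubx : supremums [set `|f x| | x in C] `|f x|.
  by split=> [_ [y Cy <-]|y]; [exact: max_x | apply; exists x].
have [ub lb] : supremums [set `|f x| | x in C]
    (xget 0 (supremums [set `|f x| | x in C])) by apply: xgetPex; exists `|f x|.
apply/le_anti/andP; split; first by apply: lb => _ [y Cy <-]; exact: max_x.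
by apply: ub; exists x.
Qed.

Lemma le_sup_norm C f x : compact C -> continuous f -> C x ->
  `|f x| <= sup_norm C f.
Proof.
move=> cptC cf Cx.
have [|y Cy max_y] := compact_norm_max cptC cf; first by exists x.
by rewrite (sup_norm_max Cy max_y); exact: max_y.
Qed.

(** The supremum is either the default 0 of the empty set or an attained value; hence even strict
    bounds pass from the values to the supremum. *)
Lemma sup_norm_ind (P : K -> Prop) C f : compact C -> continuous f ->
  P 0 -> (forall x, C x -> P `|f x|) -> P (sup_norm C f).
Proof.
move=> cptC cf P0 Pf; have [->|/set0P C0] := eqVneq C set0.
  by rewrite sup_norm0.
have [y Cy max_y] := compact_norm_max cptC cf C0.
by rewrite (sup_norm_max Cy max_y); exact: Pf.
Qed.

Lemma sup_norm_ge0 C f : compact C -> continuous f -> 0 <= sup_norm C f.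
Proof. by move=> cptC cf; exact: (@sup_norm_ind (>= 0)). Qed.

Lemma sup_norm_le C f (c : K) : compact C -> continuous f -> 0 <= c ->
  (forall x, C x -> `|f x| <= c) -> sup_norm C f <= c.
Proof. by move=> cptC cf *; exact: (@sup_norm_ind (fun s => s <= c)). Qed.

Lemma sup_norm_lt C f (c : K) : compact C -> continuous f -> 0 < c ->
  (forall x, C x -> `|f x| < c) -> sup_norm C f < c.
Proof. by move=> cptC cf *; exact: (@sup_norm_ind (fun s => s < c)). Qed.

End SupNorm.

(** * Compact subsets of subspaces and exhaustions *)

Section Subspaces.
Context (T : topologicalType).

Lemma set_val_continuous (X : set T) : continuous (val : X -> T).
Proof. exact: initial_continuous. Qed.

(** A filter on [X] pushed forward along [val] clusters at a point of [A], which lies in [X];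
    relative neighborhoods of that point come from open sets of [T]. *)
Lemma compact_preimage_val (X A : set T) :
  compact A -> A `<=` X -> compact [set x : X | A (val x)].
Proof.
move=> cptA AX G PG GA.
have [a [Aa cla]] := cptA (fmap (val : X -> T) G) (fmap_proper_filter _ PG) GA.
exists (SigSub (mem_set (AX a Aa))); split => // B N GB.
rewrite nbhsE => -[_ [[V oV <-] /= Va] ON].
have GvB : G [set x | [set val y | y in B] (val x)].
  by apply: filterS GB => y By; exists y.
have [_ [[y By <-] Vy]] := cla _ _ GvB (open_nbhs_nbhs (conj oV Va)).
by exists y; split => //; exact: ON.
Qed.

Lemma compact_image_val (X : set T) (C : set X) :
  compact C -> compact (val @` C).
Proof.
move=> cptC; apply: continuous_compact => //.
by apply: continuous_subspaceT; exact: set_val_continuous.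
Qed.

Lemma exhaustion_le (X : set T) (Xn : nat -> set T) : exhaustion X Xn ->
  forall m n, (m <= n)%N -> Xn m `<=` Xn n.
Proof.
case=> _ _ clX _ m n /subnKC <-.
elim: (n - m)%N => [|k IH]; first by rewrite addn0.
by rewrite addnS; apply: subset_trans IH _ => x /subset_closure /clX.
Qed.

Lemma exhaustion_compact (X : set T) (Xn : nat -> set T) (C : set X) :
  exhaustion X Xn -> compact C -> exists n, val @` C `<=` Xn n.
Proof.
move=> exX /compact_near_coveringP cptC; have [oX _ _ XE] := exX.
(* As the exhaustion increases, each point has a neighborhood contained in all late members;
   compactness yields one index for all of [C]. *)
have [n _ Cn] : \forall n \near \oo, C `<=` [set x | Xn n (val x)].
  apply: (cptC nat \oo (fun n x => Xn n (val x))) => x Cx.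
  have : X (val x) by exact: set_valP.
  rewrite -{1}XE => -[n _ Xnx].
  exists ([set y : X | Xn n (val y)], [set k | (n <= k)%N]) => /=.
    split; last by exists n.
    by apply: set_val_continuous; exact: open_nbhs_nbhs (conj (oX n) Xnx).
  by case=> y k [/= Xny nk]; exact: (exhaustion_le exX nk).
by exists n => _ [x Cx <-]; apply: (Cn n _ x Cx) => /=.
Qed.

End Subspaces.

Lemma iter_continuous (T : topologicalType) (psi : T -> T) m :
  continuous psi -> continuous (iter m psi).
Proof.
move=> psi_continuous; elim: m => [|m IH] x; first exact: cvg_id.
apply: (@continuous_comp _ _ _ (iter m psi) psi); first exact: IH.
exact: psi_continuous.
Qed.

(** * Sections as functions, and continuous seminorms of the compact-open topology *)

Section Sections.
Context (K : numFieldType) (Omega : topologicalType).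
Context (F : function_sheaf K Omega) (X : set Omega).

Lemma fctD (f g : F X) x : fct (f + g) x = fct f x + fct g x.
Proof. by have := fct_linear 1 f g x; rewrite scale1r mul1r. Qed.

Lemma fct0 x : fct (0 : F X) x = 0.
Proof. by apply: (addrI (fct (0 : F X) x)); rewrite -fctD !addr0. Qed.

Lemma fctZ a (f : F X) x : fct (a *: f) x = a * fct f x.
Proof. by rewrite -[a *: f]addr0 fct_linear fct0 addr0. Qed.

Lemma fctB (f g : F X) x : fct (f - g) x = fct f x - fct g x.
Proof. by rewrite fctD -scaleN1r fctZ mulN1r. Qed.

Section CompactOpen.
Hypothesis fct_continuous : forall f : F X, continuous (fct f).
Hypothesis compact_open : has_compact_open_topology F X.

Lemma sup_norm_seminorm (C : set X) : compact C ->
  seminorm (fun f : F X => sup_norm C (fct f)).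
Proof.
move=> cptC; split.
- by move=> f; exact: sup_norm_ge0.
- move=> f g; apply: sup_norm_le => //; first by rewrite addr_ge0 ?sup_norm_ge0.
  move=> x Cx; rewrite fctD (le_trans (ler_normD _ _))// lerD//;
    exact: le_sup_norm.
- move=> a f; have [->|/set0P C0] := eqVneq C set0.
    by rewrite !sup_norm0 mulr0.
  have [x Cx max_x] := compact_norm_max cptC (@fct_continuous f) C0.
  rewrite (sup_norm_max Cx max_x) (@sup_norm_max _ _ _ _ x Cx) fctZ ?normrM//.
  by move=> y Cy; rewrite !fctZ !normrM ler_wpM2l// max_x.
Qed.

Lemma sup_norm_continuous_seminorm (C : set X) : compact C ->
  continuous_seminorm (fun f : F X => sup_norm C (fct f)).
Proof.
move=> cptC; have sn := sup_norm_seminorm cptC; split => // f.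
have [sn_ge0 snD snZ] := sn.
apply/cvgrPdist_lt => e e_gt0; apply/compact_open.
exists C, e; split => // g /=; apply: le_lt_trans.
rewrite real_ler_distl ?rpredB ?ger0_real ?sn_ge0// lerBlDr.
apply/andP; split; first by rewrite -{1}(subrKC f g) (snD _ _).
rewrite -{1}(subrKC g f) (le_trans (snD _ _))// lerD2l.
by rewrite -opprB -scaleN1r snZ normrN1 mul1r.
Qed.

Lemma continuous_seminorm_le_sup_norm (p : F X -> K) : continuous_seminorm p ->
  exists2 C : set X, compact C &
    exists2 c, 0 < c & forall f, p f <= c * sup_norm C (fct f).
Proof.
case=> -[p_ge0 _ pZ] cp.
have p0 : p 0 = 0 by rewrite -(scale0r (0 : F X)) pZ normr0 mul0r.
have : nbhs (0 : F X) [set f | `|p 0 - p f| < 1].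
  exact: (cvgrPdist_lt _ _).1 (cp 0) _ ltr01.
move/compact_open => [C [e [cptC e_gt0 Cp]]]; exists C => //.
have [sn_ge0 _ snZ] := sup_norm_seminorm cptC.
have p_lt1 f : sup_norm C (fct f) < e -> p f < 1.
  move=> fe; have := Cp f.
  by rewrite /= subr0 p0 sub0r normrN ger0_norm//; exact.
(* Homogeneity rescales the unit estimate to every level [t]. *)
have p_lt t f : 0 < t -> sup_norm C (fct f) < t * e -> p f < t.
  move=> t0 fte; rewrite -(mulr1 t) -ltr_pdivrMl//.
  rewrite -[t^-1]gtr0_norm ?invr_gt0// -pZ p_lt1// snZ gtr0_norm ?invr_gt0//.
  by rewrite ltr_pdivrMl.
(* The factor 2 makes the inequality required by [p_lt] strict. If the sup norm of [f] is 0, [p_lt]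
   at level [t = p f] rules out [p f > 0]. *)
exists (2 / e); first by rewrite divr_gt0.
move=> f; have := sn_ge0 f; rewrite le_eqVlt => /predU1P[s0|s_gt0].
  rewrite -s0 mulr0; have := p_ge0 f; rewrite le_eqVlt => /predU1P[<-//|pf0].
  by have := p_lt _ f pf0; rewrite -s0 ltxx mulr_gt0// => /(_ isT).
apply/ltW/p_lt; first by rewrite mulr_gt0 ?divr_gt0.
by rewrite mulrAC divfK ?gt_eqF// ltr_pMl// ltr1n.
Qed.

End CompactOpen.

(** * The weighted composition operator and its iterates *)

Section WeightedComposition.
Variables (w : X -> K) (psi : X -> X).
Hypothesis C_well_defined : wcomp_well_defined F w psi.
Local Notation C := (@wcomp K Omega F X w psi).

Lemma fct_wcomp f x : fct (C f) x = w x * fct f (psi x).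
Proof. by have : is_wcomp w psi f (C f) by exact: xgetPex. Qed.

Lemma wcomp_linear : linear C.
Proof.
move=> a f g; apply: fct_inj; apply/funext => x.
by rewrite fct_linear !fct_wcomp fct_linear mulrDr mulrCA.
Qed.

Lemma fct_wcomp_iter m f x : fct (iter m C f) x =
  (\prod_(j < m) w (iter j psi x)) * fct f (iter m psi x).
Proof.
elim: m x => [|m IH] x; first by rewrite big_ord0 mul1r.
rewrite iterS fct_wcomp IH big_ord_recl mulrA -iterSr.
by congr (_ * _ * _); apply: eq_bigr => j _; rewrite -iterSr.
Qed.

Hypotheses (w_continuous : continuous w) (psi_continuous : continuous psi).

Lemma wcomp_continuous : (forall f : F X, continuous (fct f)) ->
  has_compact_open_topology F X -> continuous C.
Proof.
move=> fct_continuous compact_open f A /compact_open[D [e [cptD e_gt0 DA]]].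
apply/compact_open.
have cptpD : compact (psi @` D).
  by apply: continuous_compact => //; exact: continuous_subspaceT.
(* The summand 1 keeps [M] positive even if [w] vanishes on [D]. *)
pose M := 1 + sup_norm D w.
have M_gt0 : 0 < M by rewrite ltr_wpDr ?sup_norm_ge0.
exists (psi @` D), (e / M); split; rewrite ?divr_gt0// => g /= ge.
apply: DA => /=; apply: sup_norm_lt => // x Dx.
rewrite fctB !fct_wcomp -mulrBr -fctB normrM.
have wM : `|w x| <= M by rewrite (le_trans (le_sup_norm cptD _ Dx)) ?lerDr.
have gx : `|fct (g - f) (psi x)| < e / M.
  by apply: le_lt_trans ge; apply: le_sup_norm => //; exists x.
by rewrite (le_lt_trans (ler_wpM2r _ wM))// mulrC -ltr_pdivlMr//.
Qed.

(** Each factor is nonzero on an open dense set, and a dense set still meets every nonempty open set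
    after it is cut down by such a set. *)
Lemma prod_weight_dense :
  (forall m, dense [set y : X | w (iter m psi y) <> 0]) ->
  forall m, dense [set y : X | \prod_(j < m) w (iter j psi y) != 0].
Proof.
move=> dw m; elim: m => [|m IH] O O0 oO.
  by have [x Ox] := O0; exists x; split => //=; rewrite big_ord0 oner_neq0.
have oOw : open (O `&` [set y : X | w (iter m psi y) <> 0]).
  apply: openI => //.
  change (open ((w \o iter m psi) @^-1` ~` [set 0])).
  apply: open_comp => [y _|].
    by apply: continuous_comp; [exact: iter_continuous | exact: w_continuous].
  rewrite openC; apply/accessible_closed_set1/hausdorff_accessible.
  exact: (@norm_hausdorff K K).
have [y [[Oy /eqP wy] prod_y]] := IH _ (dw m O O0 oO) oOw.
by exists y; split => //=; rewrite big_ord_recr mulf_neq0.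
Qed.

End WeightedComposition.
End Sections.

(** * Gluing and approximation by global sections *)

Section Approximation.
Context (K : numFieldType) (Omega : topologicalType).
Context (F : function_sheaf K Omega).

Lemma coincide_restr X Y (f : F X) : open X -> open Y -> Y `<=` X ->
  coincide (fct f) (fct (restr Y f)).
Proof.
by move=> oX oY YX; have := xgetPex 0 (sheaf_restr oX oY YX f); exact.
Qed.

(** Disjointness makes the compatibility condition on the overlap vacuous. *)
Lemma sheaf_glue2 A B (f : F A) (g : F B) : open A -> open B ->
  A `&` B = set0 -> exists h : F (A `|` B),
    coincide (fct h) (fct f) /\ coincide (fct h) (fct g).
Proof.
move=> oA oB AB0; pose U (b : bool) := if b then A else B.
pose s (b : bool) : F (U b) := if b return F (U b) then f else g.
have disj x : A x -> B x -> False.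
  by move=> Ax Bx; have : (A `&` B) x by []; rewrite AB0.
have [||||h hE] := @sheaf_gluing _ _ F (A `|` B) bool U _ _ _ s.
- exact: openU.
- by case.
- apply/seteqP; split => [x [[] _ ?]|x []]; [by left | by right | |] => ?.
    by exists true.
  by exists false.
- move=> [] [] x y xy; try by congr (fct _ _); exact: val_inj.
  + by case: (disj (val x)); [exact: set_valP | rewrite xy; exact: set_valP].
  + by case: (disj (val x)); [rewrite xy; exact: set_valP | exact: set_valP].
- by exists h; split; [exact: (hE true) | exact: (hE false)].
Qed.

(* f is a global section whose restriction to A `|` U is close to the section
   glued from 0 on A and g on U. *)
Lemma approx_bump (X A U : set Omega) (L : set X) (z : X) (g : F X) (e : K) :
  (forall Y (f : F Y), open Y -> continuous (fct f)) ->
  (forall Y, open Y -> has_compact_open_topology F Y) ->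
  open X -> open A -> open U -> A `<=` X -> U `<=` X -> A `&` U = set0 ->
  dense (range (restr (A `|` U) : F X -> F (A `|` U))) ->
  compact L -> val @` L `<=` A -> U (val z) -> 0 < e ->
  exists f : F X,
    (forall x, L x -> `|fct f x| < e) /\ `|fct f z - fct g z| < e.
Proof.
move=> fct_cont co oX oA oU AX UX AU0 dr cptL LA Uz e0.
have oY : open (A `|` U) by exact: openU.
have YX : A `|` U `<=` X by rewrite subUset.
have [h [h0 hg]] := sheaf_glue2 0 (restr U g) oA oU AU0.
(* One compact set, [L] together with [z], carries both estimates. *)
pose C := [set x : (A `|` U) | (val @` L `|` [set val z]) (val x)].
have cptC : compact C.
  apply: compact_preimage_val.
    by apply: compactU; [exact: compact_image_val | exact: compact_set1].
  by rewrite subUset; split=> [x /LA|_ ->]; [left | right].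
have nh : nbhs h [set k | sup_norm C (fct (k - h)) < e].
  by apply/(co _ oY); exists C, e; split.
(* Density concerns open sets, so the interior of the neighborhood is used. *)
have [|k [/interior_subset fh [f _ fE]]] :=
    dr [set k | sup_norm C (fct (k - h)) < e]^° _ (@open_interior _ _).
  by exists h; exact: nh.
rewrite -fE /= in fh.
have near x : C x -> `|fct (restr (A `|` U) f) x - fct h x| < e.
  rewrite -fctB => Cx; apply: le_lt_trans fh.
  by apply: le_sup_norm => //; exact: fct_cont.
exists f; split=> [x Lx|].
- have Ax : A (val x) by apply: LA; exists x.
  pose y : A `|` U := SigSub (mem_set (or_introl Ax)).
  pose y' : A := SigSub (mem_set Ax).
  have := near y; rewrite (h0 y y')// fct0 subr0.
  rewrite -(coincide_restr f oX oY YX (x := x))//.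
  by apply; left; exists x.
- pose y : A `|` U := SigSub (mem_set (or_intror Uz)).
  pose y' : U := SigSub (mem_set Uz).
  have := near y; rewrite (hg y y')// -(coincide_restr f oX oY YX (x := z))//.
  rewrite -(coincide_restr g oX oU UX (x := z))//.
  by apply; right.
Qed.

End Approximation.

(** * The implications between the three conditions *)

Section Equivalences.
Context (K : numFieldType) (Omega : topologicalType).
Context (F : function_sheaf K Omega) (X : set Omega).
Hypothesis fct_continuous : forall Y (f : F Y), open Y -> continuous (fct f).
Hypothesis compact_open : forall Y, open Y -> has_compact_open_topology F Y.
Hypothesis X_open : open X.
Variables (w : X -> K) (psi : X -> X).
Hypotheses (w_continuous : continuous w) (psi_continuous : continuous psi).
Hypothesis C_well_defined : wcomp_well_defined F w psi.
Local Notation C := (@wcomp K Omega F X w psi).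

Lemma stable_orbits_m_topologizable : stable_orbits psi -> m_topologizable C.
Proof.
have fctX (f : F X) : continuous (fct f) by exact: fct_continuous.
have coX := compact_open X_open.
move=> so; split; [exact: wcomp_linear | exact: wcomp_continuous |].
move=> p /(continuous_seminorm_le_sup_norm fctX coX).
case=> D cptD [c c_gt0 pc]; have [L cptL psiL] := so D cptD.
have cptDL : compact (D `|` L) by exact: compactU.
(* [D] is included because the weight product starts at the point itself, while [L] contains only
   the iterates with [m > 0]. *)
exists (fun f => sup_norm (D `|` L) (fct f)).
  exact: sup_norm_continuous_seminorm.
pose M := 1 + sup_norm (D `|` L) w.
have M_ge1 : 1 <= M by rewrite lerDl sup_norm_ge0.
have M_gt0 := lt_le_trans ltr01 M_ge1; have M_ge0 := ltW M_gt0.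
(* Since [m > 0], the single factor [c] is absorbed by [(1 + c) ^+ m]. *)
exists ((1 + c) * M); first by apply: mulr_gt0 => //; exact: addr_gt0.
move=> m m_gt0 f; rewrite (le_trans (pc _))// exprMn -mulrA.
have c_le : c <= (1 + c) ^+ m.
  by rewrite (@le_trans _ _ (1 + c)) ?lerDr// ler_eXnr// lerDl ltW.
have sn_ge0 (E : set X) (g : F X) : compact E -> 0 <= sup_norm E (fct g).
  by move=> cptE; exact: sup_norm_ge0.
apply: ler_pM => //; [exact: ltW | exact: sn_ge0 |].
apply: sup_norm_le => //; first by rewrite mulr_ge0 ?exprn_ge0 ?sn_ge0.
have orbitDL j x : D x -> (D `|` L) (iter j psi x).
  by case: j => [|j] Dx; [left | right; apply: (psiL j.+1) => //; exists x].
move=> x Dx; rewrite fct_wcomp_iter// normrM normr_prod ler_pM ?prodr_ge0//.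
  rewrite -[m in leRHS]card_ord -prodr_const; apply: ler_prod => j _.
  have wj := le_sup_norm cptDL w_continuous (orbitDL j x Dx).
  by rewrite normr_ge0 (le_trans wj)// lerDr.
exact: le_sup_norm (orbitDL m x Dx).
Qed.

Lemma m_topologizable_topologizable : m_topologizable C -> topologizable C.
Proof.
case=> linC contC mtop; split => // p /mtop[q cq [c c_gt0 pq]].
by exists q => // m m_gt0; exists (c ^+ m); [exact: exprn_gt0 | exact: pq].
Qed.

Lemma topologizable_stable_orbits :
    (exists2 Xn, exhaustion X Xn &
      forall n x, (X `\` closure (Xn n)) x ->
        forall W, open W -> W `<=` X `\` closure (Xn n) -> W x ->
          exists U, [/\ open U, U `<=` W, U x &
            dense (range (restr (Xn n `|` U) : F X -> F (Xn n `|` U)))]) ->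
    (forall x : X, [set f : F X | fct f x = 0] <> [set: F X]) ->
    (forall m : nat, dense [set y : X | w (iter m psi y) <> 0]) ->
  topologizable C -> stable_orbits psi.
Proof.
case=> Xn exX approx nonzero dw [_ _ top] D cptD.
have fctX (f : F X) : continuous (fct f) by exact: fct_continuous.
have [oXn cptXn clXn XE] := exX.
have XnX n : Xn n `<=` X by rewrite -XE; exact: bigcup_sup.
have clX n : closure (Xn n) `<=` X by exact: subset_trans (XnX n.+1).
have cptcl n : compact [set x : X | closure (Xn n) (val x)].
  exact: compact_preimage_val.
have [k Dk] := exhaustion_compact exX cptD.
have coX := compact_open X_open.
have [q cq pq] := top _ (sup_norm_continuous_seminorm fctX coX (cptcl k)).
have [L cptL [c c_gt0 qL]] := continuous_seminorm_le_sup_norm fctX coX cq.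
have [n Ln] := exhaustion_compact exX cptL.
(* The index [n] was fixed before [m], so this compact set serves all iterates. *)
exists [set x : X | closure (Xn n) (val x)] => // m m_gt0 _ [x0 Dx0 <-] /=.
apply: contrapT => ncl.
have [g g_gt0 pqm] := pq m m_gt0.
have cpsi := iter_continuous (m := m) psi_continuous.
(* [V] is open and contains [x0], so it meets the dense set where the weight product is nonzero. *)
pose V := (val : X -> Omega) @^-1` Xn k `&`
  (val \o iter m psi) @^-1` ~` closure (Xn n).
have oV : open V.
  apply: openI; apply: open_comp => //.
  - by move=> x _; exact: set_val_continuous.
  - move=> x _; apply: continuous_comp; first exact: cpsi.
    exact: set_val_continuous.
  - by rewrite openC; exact: closed_closure.
have [|y [[Xky ncly] prod_y]] :=
    prod_weight_dense w_continuous psi_continuous dw m _ oV.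
  by exists x0; split => //; apply: Dk; exists x0.
pose z := iter m psi y; pose a := \prod_(j < m) w (iter j psi y).
have [h hz] : exists h : F X, fct h z != 0.
  apply: contrapT => nh; apply: (nonzero z); apply/seteqP; split => // f _ /=.
  by apply: contrapT => /eqP fz; apply: nh; exists f.
have oW : open (X `\` closure (Xn n)).
  by apply: openI => //; rewrite openC; exact: closed_closure.
have Wz : (X `\` closure (Xn n)) (val z) by split => //; exact: set_valP.
have [U [oU UW Uz dU]] := approx n _ Wz _ oW (@subset_refl _ _) Wz.
have UX : U `<=` X by move=> u /UW[].
have XnU0 : Xn n `&` U = set0.
  by apply/seteqP; split => // u [Xnu /UW[_]]; apply; exact: subset_closure.
(* The bound on [C^m f] gives [|a| |f z| <= g c e], and replacing [f z] by [h z] costs at most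
   [|a| e]. Thus [|a| |h z| <= b e], while [e] is chosen so that [b e] is half of [|a| |h z|], which
   is positive. *)
pose b := g * c + `|a|; have b_gt0 : 0 < b by rewrite ltr_wpDr ?mulr_gt0.
pose e := `|a| * `|fct h z| / 2 / b.
have ahz_gt0 : 0 < `|a| * `|fct h z| by rewrite mulr_gt0 ?normr_gt0.
have e_gt0 : 0 < e by rewrite !divr_gt0.
have [f [fL fz]] := approx_bump h fct_continuous compact_open X_open (oXn n)
  oU (XnX n) UX XnU0 dU cptL Ln Uz e_gt0.
have afz : `|a| * `|fct f z| <= g * c * e.
  rewrite -normrM -fct_wcomp_iter//.
  have cly : [set x : X | closure (Xn k) (val x)] y by exact: subset_closure.
  rewrite (le_trans (le_sup_norm (cptcl k) (fctX _) cly))//.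
  rewrite (le_trans (pqm f))// -mulrA ler_pM2l// (le_trans (qL f))// ler_pM2l//.
  by apply: sup_norm_le => // [|x /fL/ltW//]; exact: ltW.
have : `|a| * `|fct h z| <= b * e.
  rewrite mulrDl (le_trans _ (lerD afz (ler_wpM2l (normr_ge0 a) (ltW fz))))//.
  rewrite -mulrDr ler_wpM2l//.
  by rewrite -[in leLHS](subKr (fct f z) (fct h z)) ler_normB.
rewrite [b * e]mulrC divfK ?gt_eqF// lt_geF//.
by rewrite ltr_pdivrMr// ltr_pMr// ltr1n.
Qed.

End Equivalences.

Theorem corollary3p6 (R : realType) (K : numFieldType)
    (hK : scalar_field R K)
    (Omega : topologicalType)
    (Omega_hausdorff : hausdorff_space Omega)
    (Omega_locally_compact : locally_compact [set: Omega])
    (Omega_sigma_compact : sigma_compact Omega)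
    (Omega_noncompact : ~ compact [set: Omega])
    (F : function_sheaf K Omega)
    (F1 : propertyF1 F)
    (F_compact_open : forall Y, open Y -> has_compact_open_topology F Y)
    (X : set Omega) (X_open : open X)
    (w : X -> K) (w_continuous : continuous w)
    (psi : X -> X) (psi_continuous : continuous psi)
    (C_well_defined : wcomp_well_defined F w psi)
    (cond_a : exists2 Xn, exhaustion X Xn &
      forall n x, (X `\` closure (Xn n)) x ->
        forall W, open W -> W `<=` X `\` closure (Xn n) -> W x ->
          exists U, [/\ open U, U `<=` W, U x &
            dense (range (restr (Xn n `|` U) : F X -> F (Xn n `|` U)))])
    (cond_b : forall x : X, [set f : F X | fct f x = 0] <> [set: F X])
    (cond_c : forall m : nat, dense [set y : X | w (iter m psi y) <> 0]) :
  let C := @wcomp K Omega F X w psi in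
  (m_topologizable C <-> topologizable C) /\
  (topologizable C <-> stable_orbits psi).
Proof.
have fct_continuous Y (f : F Y) : open Y -> continuous (fct f).
  by move=> oY; have [_ _ cont _ _] := F1 Y oY; exact: cont.
have mt := @m_topologizable_topologizable K Omega F X w psi.
have so := topologizable_stable_orbits fct_continuous F_compact_open X_open
  w_continuous psi_continuous C_well_defined cond_a cond_b cond_c.
have sm := stable_orbits_m_topologizable fct_continuous F_compact_open X_open
  w_continuous psi_continuous C_well_defined.
(* The three implications form a cycle. *)
by split; split; auto.
Qed.
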